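(* Let $3\le\alpha<\omega$. An equation (in the language $+,-,c_i,d_{ij},p_{ij}$, $i,j<\alpha$) is true in $\mathcal{F}m^+$ if and only if it is a logical consequence of (P1)--(P7).
   Context: Consider first-order formulas with exactly the variables $v_i$ $(i<\alpha)$, over an arbitrary vocabulary of relation symbols (no assumption on the relation symbols is needed), without function or constant symbols. The logical connectives are $\lor,\neg,\exists v_i$, and $v_i=v_j$ (regarded as a nullary connective) for $i,j<\alpha$. The formula algebra $\mathcal{F}m$ has as universe the set of all formulas (as syntactic objects, not up to equivalence) and operations $\varphi+\psi=(\varphi\lor\psi)$, $-\varphi=\neg\varphi$, $c_i\varphi=\exists v_i\varphi$, and the constant $d_{ij}$ is the formula $v_i=v_j$. For $i,j<\alpha$, $p_{ij}$ is the unary function on formulas interchanging all occurrences (free, bound, and in quantifiers) of the variables $v_i$ and $v_j$; $\mathcal{F}m^+$ is $\mathcal{F}m$ expanded with the unary operations $p_{ij}$ $(i,j<\alpha)$. For $i,j<\alpha$ let $\tau=[i,j]$ be the function on $\alpha$ interchanging $i$ and $j$ and fixing everything else. The equations, for all $i,j,k,l<\alpha$, are: (P1) $p_{ij}(x+y)=p_{ij}x+p_{ij}y$; (P2) $p_{ij}(-x)=-p_{ij}x$; (P3) $p_{ij}(c_kx)=c_{\tau(k)}p_{ij}x$; (P4) $p_{ij}d_{kl}=d_{\tau(k)\tau(l)}$; (P5) $p_{ij}p_{kl}x=p_{\tau(k)\tau(l)}p_{ij}x$; (P6) $p_{ij}p_{ij}x=x$; (P7) $p_{ii}x=x$. *)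

(* Defs.v *)
From mathcomp Require Import all_boot all_fingroup.

Set Implicit Arguments.
Unset Strict Implicit.
Unset Printing Implicit Defensive.

Record algebra (alpha : nat) := Algebra {
  carrier :> Type;
  add : carrier -> carrier -> carrier;
  neg : carrier -> carrier;
  cyl : 'I_alpha -> carrier -> carrier;
  diag : 'I_alpha -> 'I_alpha -> carrier;
  interch : 'I_alpha -> 'I_alpha -> carrier -> carrier
}.

Inductive term (alpha : nat) : Type :=
| TVar of nat
| TAdd of term alpha & term alpha
| TNeg of term alpha
| TCyl of 'I_alpha & term alpha
| TDiag of 'I_alpha & 'I_alpha
| TP of 'I_alpha & 'I_alpha & term alpha.

Arguments TVar {alpha} n.

Fixpoint eval (alpha : nat) (A : algebra alpha) (v : nat -> A)
    (t : term alpha) : A :=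
  match t with
  | TVar n => v n
  | TAdd s t => add (eval v s) (eval v t)
  | TNeg t => neg (eval v t)
  | TCyl i t => cyl i (eval v t)
  | TDiag i j => diag A i j
  | TP i j t => interch i j (eval v t)
  end.

Record equation (alpha : nat) := Equation {
  lhs : term alpha;
  rhs : term alpha
}.

Definition true_in (alpha : nat) (A : algebra alpha) (e : equation alpha) :
    Prop :=
  forall v : nat -> A, eval v (lhs e) = eval v (rhs e).

Definition logical_consequence (alpha : nat)
    (Sigma : equation alpha -> Prop) (e : equation alpha) : Prop :=
  forall A : algebra alpha,
    (forall e', Sigma e' -> true_in A e') -> true_in A e.

Inductive P_axiom (alpha : nat) : equation alpha -> Prop :=
| P1 i j : P_axiom (Equation
    (TP i j (TAdd (TVar 0) (TVar 1)))
    (TAdd (TP i j (TVar 0)) (TP i j (TVar 1))))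
| P2 i j : P_axiom (Equation
    (TP i j (TNeg (TVar 0)))
    (TNeg (TP i j (TVar 0))))
| P3 i j k : P_axiom (Equation
    (TP i j (TCyl k (TVar 0)))
    (TCyl (tperm i j k) (TP i j (TVar 0))))
| P4 i j k l : P_axiom (Equation
    (TP i j (TDiag k l))
    (TDiag (tperm i j k) (tperm i j l)))
| P5 i j k l : P_axiom (Equation
    (TP i j (TP k l (TVar 0)))
    (TP (tperm i j k) (tperm i j l) (TP i j (TVar 0))))
| P6 i j : P_axiom (Equation
    (TP i j (TP i j (TVar 0)))
    (TVar 0))
| P7 i : P_axiom (Equation
    (TP i i (TVar 0))
    (TVar 0)).

Record vocabulary := Vocabulary {
  rel_symbol :> Type;
  arity : rel_symbol -> nat
}.

Inductive formula (L : vocabulary) (alpha : nat) : Type :=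
| FRel (R : L) of (arity R).-tuple 'I_alpha
| FEq of 'I_alpha & 'I_alpha
| FOr of formula L alpha & formula L alpha
| FNot of formula L alpha
| FEx of 'I_alpha & formula L alpha.

Fixpoint swap_vars (L : vocabulary) (alpha : nat) (i j : 'I_alpha)
    (phi : formula L alpha) : formula L alpha :=
  match phi with
  | FRel R xs => FRel (map_tuple (tperm i j) xs)
  | FEq k l => FEq L (tperm i j k) (tperm i j l)
  | FOr phi psi => FOr (swap_vars i j phi) (swap_vars i j psi)
  | FNot phi => FNot (swap_vars i j phi)
  | FEx k phi => FEx (tperm i j k) (swap_vars i j phi)
  end.

(* Elements are raw syntax trees: equality is syntactic identity, with no
   quotient by logical equivalence or renaming of bound variables. *)
Definition Fm_plus (L : vocabulary) (alpha : nat) : algebra alpha :=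
  @Algebra alpha (formula L alpha) (@FOr L alpha) (@FNot L alpha)
    (@FEx L alpha) (@FEq L alpha) (@swap_vars L alpha).

(* Main.v *)
Require Import Defs.
From mathcomp Require Import all_boot all_fingroup.

(** Over (P1)-(P7) every term can be rewritten so that interchanges act on
    variables only: (P1)-(P4) push them inwards.  A string of interchanges in
    front of a variable matters only through the permutation of the indices
    that it composes to, because (P5)-(P7) present the symmetric group on its
    transpositions ([word_equivP]).  A term thus amounts to a p-free term whose
    variables are pairs (variable, permutation), its normal form, and
    equality of normal forms implies derivability from (P1)-(P7).

    Conversely, two terms with different normal forms are separated by one
    valuation in the formula algebra.  That algebra is freely generated under
    its connectives other than the interchanges, so the only danger is that
    the formula put for a variable coincides with the value of a compound
    term, or that two pairs (variable, permutation) get the same formula.  The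
    first is excluded by size: all the formulas [test_formula] put for the
    variables have one common size, larger than the terms considered; a
    compound term has a smaller value if it is variable-free and a larger one
    otherwise.  The second is excluded by a quantifier prefix running through
    all the variables, in which a permutation can be read off, followed by a
    code of the index of the variable.  Only equality formulas occur in them,
    whence the independence of the vocabulary. *)

Local Open Scope group_scope.

(** * Interchanges present the symmetric group *)

(** Laws (P5)-(P7), stated for an arbitrary carrier so that permutations
    themselves form an instance. *)
Record interchange_laws {alpha : nat} {T : Type}
    (p : 'I_alpha -> 'I_alpha -> T -> T) : Prop := InterchangeLaws {
  interch_conj : forall i j k l x,
    p i j (p k l x) = p (tperm i j k) (tperm i j l) (p i j x);
  interch_invol : forall i j x, p i j (p i j x) = x;
  interch_id : forall i x, p i i x = x
}.

Definition word_act {alpha : nat} {T : Type}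
    (p : 'I_alpha -> 'I_alpha -> T -> T) (w : seq ('I_alpha * 'I_alpha))
    (x : T) : T :=
  foldr (fun ij => p ij.1 ij.2) x w.

(** Quantifying over all types makes this derivability from (P5)-(P7). *)
Definition word_equiv {alpha : nat} (w w' : seq ('I_alpha * 'I_alpha)) :=
  forall (T : Type) (p : 'I_alpha -> 'I_alpha -> T -> T),
    interchange_laws p -> word_act p w =1 word_act p w'.

(** Products in [{perm _}] apply the left factor first, whereas the head of a
    word acts last: hence the multiplication on the right. *)
Definition perm_interch {alpha : nat} (i j : 'I_alpha)
    (s : {perm 'I_alpha}) : {perm 'I_alpha} := s * tperm i j.

Definition word_perm {alpha : nat} (w : seq ('I_alpha * 'I_alpha)) :
  {perm 'I_alpha} := word_act perm_interch w 1.

Arguments word_perm : simpl never.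

Lemma tpermJ_tperm {alpha : nat} (i j k l : 'I_alpha) :
  tperm k l * tperm i j = tperm i j * tperm (tperm i j k) (tperm i j l).
Proof. by rewrite -tpermJ conjgE tpermV !mulgA tperm2 mul1g. Qed.

Lemma perm_interch_laws {alpha : nat} :
  interchange_laws (@perm_interch alpha).
Proof.
split=> [i j k l s | i j s | i s]; rewrite /perm_interch.
- by rewrite -!mulgA tpermJ_tperm.
- by rewrite -mulgA tperm2 mulg1.
- by rewrite tperm1 mulg1.
Qed.

Lemma word_act_rcons {alpha : nat} {T : Type}
    (p : 'I_alpha -> 'I_alpha -> T -> T) w ij x :
  word_act p (rcons w ij) x = word_act p w (p ij.1 ij.2 x).
Proof. by rewrite /word_act foldr_rcons. Qed.

Lemma word_act_cat {alpha : nat} {T : Type}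
    (p : 'I_alpha -> 'I_alpha -> T -> T) w w' x :
  word_act p (w ++ w') x = word_act p w (word_act p w' x).
Proof. by rewrite /word_act foldr_cat. Qed.

Lemma word_perm_cons {alpha : nat} (i j : 'I_alpha) w :
  word_perm ((i, j) :: w) = word_perm w * tperm i j.
Proof. by []. Qed.

Lemma word_perm_cat {alpha : nat} (w w' : seq ('I_alpha * 'I_alpha)) :
  word_perm (w ++ w') = word_perm w' * word_perm w.
Proof.
elim: w => [|[i j] w IHw]; first by rewrite mulg1.
by rewrite cat_cons !word_perm_cons IHw mulgA.
Qed.

Lemma word_perm_rcons {alpha : nat} (w : seq ('I_alpha * 'I_alpha)) i j :
  word_perm (rcons w (i, j)) = tperm i j * word_perm w.
Proof. by rewrite -cats1 word_perm_cat word_perm_cons mul1g. Qed.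

Lemma word_equiv_perm {alpha : nat} (w w' : seq ('I_alpha * 'I_alpha)) :
  word_equiv w w' -> word_perm w = word_perm w'.
Proof. by move=> eqv; apply: eqv perm_interch_laws _. Qed.

Lemma interch_sym {alpha : nat} {T : Type}
    {p : 'I_alpha -> 'I_alpha -> T -> T} (pP : interchange_laws p) i j x :
  p i j x = p j i x.
Proof.
(* The conjugate of an interchange by itself is the one with swapped indices. *)
have := interch_conj _ pP i j i j (p i j x).
by rewrite !(interch_invol _ pP) tpermL tpermR.
Qed.

Lemma word_act_conj {alpha : nat} {T : Type}
    {p : 'I_alpha -> 'I_alpha -> T -> T} (pP : interchange_laws p) w i j x :
  p (word_perm w i) (word_perm w j) (word_act p w x) = word_act p w (p i j x).
Proof.
elim: w => [|[k l] w IHw] /=; first by rewrite !perm1.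
by rewrite word_perm_cons !permM -(interch_conj _ pP) IHw.
Qed.

Lemma word_act_revK {alpha : nat} {T : Type}
    {p : 'I_alpha -> 'I_alpha -> T -> T} (pP : interchange_laws p) w x :
  word_act p w (word_act p (rev w) x) = x.
Proof.
elim: w x => [|[k l] w IHw] x //=.
by rewrite rev_cons word_act_rcons IHw (interch_invol _ pP).
Qed.

Definition avoids {alpha : nat} (a : 'I_alpha) :
  pred (seq ('I_alpha * 'I_alpha)) := all (fun ij => (ij.1 != a) && (ij.2 != a)).

Lemma avoids_fix {alpha : nat} (a : 'I_alpha) w :
  avoids a w -> word_perm w a = a.
Proof.
elim: w => [|[i j] w IHw] /=; first by rewrite perm1.
by case/andP=> /andP[ia ja] /IHw wa; rewrite word_perm_cons permM wa tpermD.
Qed.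

(** The interchanges involving [a] can be collected into a single one at the
    end of the word: moving [(a, j)] to the right past a word avoiding [a]
    only changes [j], and [(a, d)(a, c)] equals [(d, c')(a, d)]
    by (P5).  The case [c' = a] covers words from which [a] disappears. *)
Lemma collect_index {alpha : nat} (a c : 'I_alpha) w :
  exists w' c', [/\ size w' <= size w, avoids a w' &
    word_equiv (rcons w (a, c)) (rcons w' (a, c'))].
Proof.
elim: w => [|[i j] w [w1 [c1 [le_w1 av_w1 eqv_w1]]]].
  by exists [::], c.
have eqv_cons: word_equiv (rcons ((i, j) :: w) (a, c))
                          ((i, j) :: rcons w1 (a, c1)).
  by move=> T p pP x /=; rewrite eqv_w1.
have [eq_ij | neq_ij] := eqVneq i j.
  exists w1, c1; split=> //; first exact: leqW.
  by move=> T p pP x; rewrite eqv_cons //= eq_ij (interch_id _ pP).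
have [/andP[ia ja] | meets_a] := boolP ((i != a) && (j != a)).
  by exists ((i, j) :: w1), c1; split=> //; rewrite /= ia ja.
have [b ba eqv_b]: exists2 b, b != a &
    word_equiv (rcons ((i, j) :: w) (a, c)) ((a, b) :: rcons w1 (a, c1)).
  move: meets_a; rewrite negb_and !negbK => /orP[] /eqP eq_a.
    by exists j; [rewrite eq_sym -eq_a | rewrite -{2}eq_a].
  exists i; first by rewrite -eq_a.
  move=> T p pP x; rewrite eqv_cons //= (interch_sym pP).
  by rewrite {1}eq_a.
pose d := (word_perm w1)^-1 b.
have da: d != a.
  apply: contra ba => /eqP eq_da.
  by rewrite -(permKV (word_perm w1) b) -/d eq_da avoids_fix.
have eqv_d: word_equiv (rcons ((i, j) :: w) (a, c))
    (rcons (rcons w1 (a, d)) (a, c1)).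
  move=> T p pP x; rewrite eqv_b //= !word_act_rcons /=.
  by rewrite -[RHS](word_act_conj pP) permKV avoids_fix.
have [eq_c1a | c1a] := eqVneq c1 a.
  exists w1, d; split=> //; first exact: leqW.
  by move=> T p pP x; rewrite eqv_d // word_act_rcons eq_c1a (interch_id _ pP).
have [eq_c1d | c1d] := eqVneq c1 d.
  exists w1, a; split=> //; first exact: leqW.
  move=> T p pP x; rewrite eqv_d // !word_act_rcons /= eq_c1d.
  by rewrite (interch_invol _ pP) (interch_id _ pP).
exists (rcons w1 (d, c1)), d; split.
- by rewrite size_rcons.
- by rewrite /avoids all_rcons /= da c1a.
- move=> T p pP x; rewrite eqv_d // !word_act_rcons /=.
  by rewrite (interch_conj _ pP) tpermL tpermD // eq_sym.
Qed.

(** Collecting the interchanges that involve an index of the last letter leaves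
    a trivial interchange there, since the permutation fixes that index;
    what remains is a shorter word. *)
Lemma word_equiv_nil {alpha : nat} (w : seq ('I_alpha * 'I_alpha)) :
  word_perm w = 1 -> word_equiv w [::].
Proof.
have [n] := ubnP (size w); elim: n w => // n IHn w.
case/lastP: w => [|w [a c]] // le_wn perm_w.
have [w' [c' [le_w' av_w' eqv_w]]] := collect_index a c w.
have perm_w': tperm a c' * word_perm w' = 1.
  by rewrite -word_perm_rcons -(word_equiv_perm _ _ eqv_w).
have c'a: c' = a.
  have := congr1 (fun s : {perm _} => s c') perm_w'.
  by rewrite permM tpermR avoids_fix // perm1.
rewrite c'a in perm_w' eqv_w; rewrite tperm1 mul1g in perm_w'.
move=> T p pP x; rewrite eqv_w // word_act_rcons (interch_id _ pP).
apply: IHn => //; apply: leq_ltn_trans le_w' _.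
by move: le_wn; rewrite size_rcons ltnS.
Qed.

(** The reversed word acts as the inverse, so the comparison of two words
    reduces to that of one word with the empty one. *)
Lemma word_equivP {alpha : nat} (w w' : seq ('I_alpha * 'I_alpha)) :
  word_perm w = word_perm w' -> word_equiv w w'.
Proof.
move=> eq_ww'.
have perm_rev: word_perm (rev w ++ w') = 1.
  have: word_equiv (rev w ++ w) [::].
    move=> T p pP x; rewrite word_act_cat.
    by rewrite -{2}(revK w) (word_act_revK pP).
  by move/word_equiv_perm; rewrite !word_perm_cat eq_ww'.
move=> T p pP x; rewrite -(word_act_revK pP w (word_act p w' x)).
by rewrite -(word_act_cat p (rev w)) (word_equiv_nil _ perm_rev).
Qed.

Lemma word_exists {alpha : nat} (s : {perm 'I_alpha}) :
  exists w : seq ('I_alpha * 'I_alpha), word_perm w == s.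
Proof.
have [ts -> _] := prod_tpermP s.
elim: ts => [|[i j] ts [w /eqP perm_w]]; first by exists [::]; rewrite big_nil.
by exists (rcons w (i, j)); rewrite word_perm_rcons big_cons perm_w.
Qed.

Definition perm_word {alpha : nat} (s : {perm 'I_alpha}) :
  seq ('I_alpha * 'I_alpha) := xchoose (word_exists s).

Lemma perm_wordK {alpha : nat} (s : {perm 'I_alpha}) :
  word_perm (perm_word s) = s.
Proof. exact/eqP/(xchooseP (word_exists s)). Qed.

(** * Normal forms *)

(** [NVar n s] stands for the variable [n] acted upon by [s]. *)
Inductive nform (alpha : nat) : Type :=
| NVar of nat & {perm 'I_alpha}
| NAdd of nform alpha & nform alpha
| NNeg of nform alpha
| NCyl of 'I_alpha & nform alpha
| NDiag of 'I_alpha & 'I_alpha.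

Arguments NVar {alpha} n s.
Arguments NAdd {alpha} a b.
Arguments NNeg {alpha} a.
Arguments NCyl {alpha} i a.
Arguments NDiag {alpha} i j.

(** The normal form of [t] acted upon by [s]. *)
Fixpoint normalize {alpha : nat} (s : {perm 'I_alpha}) (t : term alpha) :
    nform alpha :=
  match t with
  | TVar n => NVar n s
  | TAdd t u => NAdd (normalize s t) (normalize s u)
  | TNeg t => NNeg (normalize s t)
  | TCyl i t => NCyl (s i) (normalize s t)
  | TDiag i j => NDiag (s i) (s j)
  | TP i j t => normalize (tperm i j * s) t
  end.

Fixpoint neval {alpha : nat} {A : algebra alpha}
    (v : nat -> {perm 'I_alpha} -> A) (a : nform alpha) : A :=
  match a with
  | NVar n s => v n s
  | NAdd a b => add (neval v a) (neval v b)
  | NNeg a => neg (neval v a)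
  | NCyl i a => cyl i (neval v a)
  | NDiag i j => diag A i j
  end.

(** A symmetric group action extending the interchanges and compatible with
    the operations, as they exist on models of (P1)-(P7). *)
Record compatible_action {alpha : nat} {A : algebra alpha}
    (act : {perm 'I_alpha} -> A -> A) : Prop := CompatibleAction {
  act_one : forall x, act 1 x = x;
  act_interch : forall i j s x,
    act (tperm i j * s) x = act s (interch i j x);
  act_add : forall s x y, act s (add x y) = add (act s x) (act s y);
  act_neg : forall s x, act s (neg x) = neg (act s x);
  act_cyl : forall s i x, act s (cyl i x) = cyl (s i) (act s x);
  act_diag : forall s i j, act s (diag A i j) = diag A (s i) (s j)
}.

Lemma act_eval {alpha : nat} {A : algebra alpha}
    {act : {perm 'I_alpha} -> A -> A} (actP : compatible_action act)
    (v : nat -> A) s t :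
  act s (eval v t) = neval (fun n s => act s (v n)) (normalize s t).
Proof.
elim: t s => [n|t IHt u IHu|t IHt|i t IHt|i j|i j t IHt] s //=.
- by rewrite (act_add _ actP) IHt IHu.
- by rewrite (act_neg _ actP) IHt.
- by rewrite (act_cyl _ actP) IHt.
- exact: act_diag actP _ _ _.
- by rewrite -(act_interch _ actP) IHt.
Qed.

Lemma eval_normalize {alpha : nat} {A : algebra alpha}
    {act : {perm 'I_alpha} -> A -> A} (actP : compatible_action act)
    (v : nat -> A) t :
  eval v t = neval (fun n s => act s (v n)) (normalize 1 t).
Proof. by rewrite -(act_eval actP) (act_one _ actP). Qed.

Definition model_act {alpha : nat} {A : algebra alpha} (s : {perm 'I_alpha}) :
  A -> A := word_act (@interch alpha A) (perm_word s).

Lemma model_actP {alpha : nat} {A : algebra alpha} :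
  (forall e, P_axiom e -> true_in A e) -> compatible_action (@model_act alpha A).
Proof.
move=> AP.
pose val2 (x y : A) n := if n is 0 then x else y.
have pP: interchange_laws (@interch alpha A).
  split=> [i j k l x | i j x | i x].
  - exact: AP _ (P5 i j k l) (val2 x x).
  - exact: AP _ (P6 i j) (val2 x x).
  - exact: AP _ (P7 i) (val2 x x).
have word_act_cyl w i (x : A) :
    word_act (@interch alpha A) w (cyl i x)
    = cyl (word_perm w i) (word_act (@interch alpha A) w x).
  elim: w => [|[k l] w /= ->]; first by rewrite perm1.
  by rewrite word_perm_cons permM; apply: AP _ (P3 k l _) (val2 _ x).
have word_act_diag w i j :
    word_act (@interch alpha A) w (diag A i j)
    = diag A (word_perm w i) (word_perm w j).
  elim: w => [|[k l] w /= ->]; first by rewrite !perm1.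
  by rewrite word_perm_cons !permM; apply: AP _ (P4 k l _ _) (fun=> diag A i j).
split; rewrite /model_act.
- by move=> x; rewrite (word_equivP _ [::]) // perm_wordK.
- move=> i j s x; rewrite -(word_act_rcons (@interch alpha A) _ (i, j)).
  by apply: word_equivP pP _; rewrite word_perm_rcons !perm_wordK.
- move=> s x y; elim: (perm_word s) => [|[k l] w /= ->] //.
  exact: AP _ (P1 k l) (val2 _ _).
- move=> s x; elim: (perm_word s) => [|[k l] w /= ->] //.
  exact: AP _ (P2 k l) (val2 _ x).
- by move=> s i x; rewrite word_act_cyl perm_wordK.
- by move=> s i j; rewrite word_act_diag perm_wordK.
Qed.

(** * The formula algebra as a model *)

Fixpoint rename {L : vocabulary} {alpha : nat} (f : 'I_alpha -> 'I_alpha)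
    (phi : formula L alpha) : formula L alpha :=
  match phi with
  | FRel R xs => FRel (map_tuple f xs)
  | FEq i j => FEq L (f i) (f j)
  | FOr phi psi => FOr (rename f phi) (rename f psi)
  | FNot phi => FNot (rename f phi)
  | FEx i phi => FEx (f i) (rename f phi)
  end.

Lemma swap_vars_rename {L : vocabulary} {alpha : nat} (i j : 'I_alpha)
    (phi : formula L alpha) :
  swap_vars i j phi = rename (tperm i j) phi.
Proof. by elim: phi => //= [phi -> psi ->|phi ->|k phi ->]. Qed.

Lemma rename_comp {L : vocabulary} {alpha : nat} (f g h : 'I_alpha -> 'I_alpha)
    (phi : formula L alpha) :
  (forall i, f (g i) = h i) -> rename f (rename g phi) = rename h phi.
Proof.
move=> fg; elim: phi => [R xs|i j|phi IH psi IH'|phi IH|i phi IH] /=.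
- congr FRel; apply: val_inj; rewrite /= -map_comp.
  by apply: eq_map => i /=.
- by rewrite !fg.
- by rewrite IH IH'.
- by rewrite IH.
- by rewrite IH fg.
Qed.

Lemma rename_id {L : vocabulary} {alpha : nat} (f : 'I_alpha -> 'I_alpha)
    (phi : formula L alpha) :
  (forall i, f i = i) -> rename f phi = phi.
Proof.
move=> fE; elim: phi => [R xs|i j|phi IH psi IH'|phi IH|i phi IH] /=;
  rewrite ?fE ?IH ?IH' //.
by congr FRel; apply: val_inj; rewrite /= -[RHS]map_id; apply: eq_map.
Qed.

Lemma Fm_plus_P {L : vocabulary} {alpha : nat} (e : equation alpha) :
  P_axiom e -> true_in (Fm_plus L alpha) e.
Proof.
case=> [i j|i j|i j k|i j k l|i j k l|i j|i] v //=; rewrite !swap_vars_rename.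
- have comp (s t : {perm 'I_alpha}) :
      rename t (rename s (v 0)) = rename (s * t) (v 0).
    by apply: rename_comp => m; rewrite permM.
  by rewrite !comp tpermJ_tperm.
- by rewrite (rename_comp _ _ id) ?rename_id // => k; rewrite tpermK.
- by rewrite rename_id // => k; rewrite tperm1 perm1.
Qed.

Lemma rename_action {L : vocabulary} {alpha : nat} :
  @compatible_action alpha (Fm_plus L alpha) (fun s => rename s).
Proof.
split=> //= [phi | i j s phi]; first by apply: rename_id => i; rewrite perm1.
by rewrite swap_vars_rename; apply/esym/rename_comp => k; rewrite permM.
Qed.

(** * Separating normal forms by a valuation *)

Fixpoint fsize {L : vocabulary} {alpha : nat} (phi : formula L alpha) : nat :=
  match phi with
  | FRel _ _ | FEq _ _ => 1
  | FOr phi psi => (fsize phi + fsize psi).+1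
  | FNot phi | FEx _ phi => (fsize phi).+1
  end.

(** Counting a variable by its index makes this bound both the size of
    variable-free normal forms and the indices of the variables. *)
Fixpoint weight {alpha : nat} (a : nform alpha) : nat :=
  match a with
  | NVar n _ => n
  | NAdd a b => (weight a + weight b).+1
  | NNeg a | NCyl _ a => (weight a).+1
  | NDiag _ _ => 1
  end.

Definition is_nvar {alpha : nat} (a : nform alpha) : bool :=
  if a is NVar _ _ then true else false.

Section Separation.

Variables (L : vocabulary) (alpha M K : nat).
Variable g : nat -> {perm 'I_alpha} -> Fm_plus L alpha.
Hypothesis ltMK : M < K.
Hypothesis size_g : forall n s, n <= M -> fsize (g n s) = K.
Hypothesis inj_g : forall n m s t,
  n <= M -> m <= M -> g n s = g m t -> n = m /\ s = t.

(** A subterm that is a variable already contributes [K], and any connective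
    above it adds to that; without variables, the formula is the normal form
    itself, whose size its weight bounds. *)
Lemma fsize_neval a : weight a <= M ->
  (fsize (neval g a) <= weight a) || (K + ~~ is_nvar a <= fsize (neval g a)).
Proof.
elim: a => [n s|a IHa b IHb|a IHa|i a IHa|i j] //= le_aM.
- by rewrite size_g // addn0 leqnn orbT.
- have leaM: weight a <= M by apply: leq_trans le_aM; rewrite leqW ?leq_addr.
  have lebM: weight b <= M by apply: leq_trans le_aM; rewrite leqW ?leq_addl.
  rewrite addn1 !ltnS.
  case/orP: (IHa leaM) => [lea | gea]; last first.
    by rewrite (leq_trans (leq_trans (leq_addr _ _) gea)) ?leq_addr ?orbT.
  case/orP: (IHb lebM) => [leb | geb]; last first.
    by rewrite (leq_trans (leq_trans (leq_addr _ _) geb)) ?leq_addl ?orbT.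
  by rewrite leq_add.
- rewrite addn1 !ltnS; case/orP: (IHa (ltnW le_aM)) => [-> // | gea].
  by rewrite (leq_trans (leq_addr _ _) gea) orbT.
- rewrite addn1 !ltnS; case/orP: (IHa (ltnW le_aM)) => [-> // | gea].
  by rewrite (leq_trans (leq_addr _ _) gea) orbT.
Qed.

Lemma neval_neq_g a n s : ~~ is_nvar a -> weight a <= M -> n <= M ->
  neval g a <> g n s.
Proof.
move=> cpd_a le_aM le_nM eq_ag.
have := fsize_neval a le_aM; rewrite eq_ag size_g // cpd_a addn1 ltnn orbF.
by move=> leKa; have := leq_trans ltMK (leq_trans leKa le_aM); rewrite ltnn.
Qed.

(** The formula algebra is free under the connectives, so the two normal forms
    can be compared from the top; [neval_neq_g] excludes that a variable on one
    side faces a compound normal form on the other. *)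
Lemma neval_inj a b : weight a <= M -> weight b <= M ->
  neval g a = neval g b -> a = b.
Proof.
have var_neq c n s : ~~ is_nvar c -> weight c <= M -> n <= M ->
  g n s = neval g c -> NVar n s = c.
  by move=> cpd_c le_cM le_nM /esym /neval_neq_g[].
elim: a b => [n s|a1 IH1 a2 IH2|a IHa|i a IHa|i j] b.
- case: b => [m t|b1 b2|b|k b|k l] lea leb; try exact: var_neq.
  by case/inj_g => // -> ->.
- case: b => [m t|b1 b2|b|k b|k l] lea leb //=;
    try by move=> /esym eq_ab; apply/esym/var_neq.
  have [lea1 lea2]: weight a1 <= M /\ weight a2 <= M.
    by split; apply: leq_trans lea; rewrite leqW ?leq_addr ?leq_addl.
  have [leb1 leb2]: weight b1 <= M /\ weight b2 <= M.
    by split; apply: leq_trans leb; rewrite leqW ?leq_addr ?leq_addl.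
  by case=> /IH1-> // /IH2->.
- case: b => [m t|b1 b2|b|k b|k l] lea leb //=;
    try by move=> /esym eq_ab; apply/esym/var_neq.
  by case=> /IHa-> //; apply: ltnW.
- case: b => [m t|b1 b2|b|k b|k l] lea leb //=;
    try by move=> /esym eq_ab; apply/esym/var_neq.
  by case=> -> /IHa-> //; apply: ltnW.
- case: b => [m t|b1 b2|b|k b|k l] lea leb //=;
    try by move=> /esym eq_ab; apply/esym/var_neq.
  by case=> -> ->.
Qed.

End Separation.

Section TestFormulas.

Variables (L : vocabulary) (alpha M : nat) (i0 : 'I_alpha).

(** The numbers of negations on both sides of the disjunction are [n] and its
    complement, so that the size does not depend on [n]. *)
Definition marker (n : nat) (i : 'I_alpha) : formula L alpha :=
  FOr (iter n (@FNot L alpha) (FEq L i i))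
      (iter (M - n) (@FNot L alpha) (FEq L i i)).

Definition test_formula (n : nat) : formula L alpha :=
  foldr (@FEx L alpha) (marker n i0) (enum 'I_alpha).

Lemma rename_negs f n (phi : formula L alpha) :
  rename f (iter n (@FNot L alpha) phi) = iter n (@FNot L alpha) (rename f phi).
Proof. by elim: n => //= n ->. Qed.

Lemma fsize_negs n (phi : formula L alpha) :
  fsize (iter n (@FNot L alpha) phi) = n + fsize phi.
Proof. by elim: n => //= n ->. Qed.

Lemma rename_test f n :
  rename f (test_formula n)
  = foldr (@FEx L alpha) (marker n (f i0)) (map f (enum 'I_alpha)).
Proof.
rewrite /test_formula; elim: (enum 'I_alpha) => [|i r /= ->] //=.
by rewrite /marker !rename_negs.
Qed.

Lemma fsize_test n f : n <= M ->
  fsize (rename f (test_formula n)) = alpha + M.+3.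
Proof.
move=> le_nM; rewrite rename_test -[in RHS](size_enum_ord alpha).
elim: (enum 'I_alpha) => [|i r /= ->] //=.
by rewrite !fsize_negs /= !addn1 addSn addnS subnKC.
Qed.

(** The quantifier prefix lists the values of the permutation, and the marker
    has [n] negations in its left disjunct. *)
Lemma test_formula_inj n m (s t : {perm 'I_alpha}) :
  rename s (test_formula n) = rename t (test_formula m) -> n = m /\ s = t.
Proof.
rewrite !rename_test => eq_st.
have [eq_nm eq_map]: n = m /\ {in enum 'I_alpha, s =1 t}.
  elim: (enum 'I_alpha) eq_st => [|i r IHr] /= [].
    by move=> /(congr1 fsize); rewrite !fsize_negs /= !addn1 => -[->] _.
  move=> eq_i /IHr[-> eq_r]; split=> // j.
  by rewrite inE => /predU1P[-> | /eq_r].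
by split=> //; apply/permP => i; apply: eq_map; rewrite mem_enum.
Qed.

End TestFormulas.

Lemma normalize_eq_of_true {L : vocabulary} {alpha : nat} (i0 : 'I_alpha)
    (e : equation alpha) :
  true_in (Fm_plus L alpha) e -> normalize 1 (lhs e) = normalize 1 (rhs e).
Proof.
set a := normalize 1 (lhs e); set b := normalize 1 (rhs e) => true_e.
pose M := weight a + weight b.
have:= true_e (test_formula L alpha M i0).
rewrite !(eval_normalize rename_action) -/a -/b.
apply: (@neval_inj L alpha M (alpha + M.+3)).
- by rewrite !addnS !ltnS (leq_trans (leq_addl alpha M)) ?leqW.
- by move=> n s; apply: fsize_test.
- by move=> n m s t _ _; apply: test_formula_inj.
- exact: leq_addr.
- exact: leq_addl.
Qed.

Theorem theorem6 (alpha : nat) (halpha : 3 <= alpha) (L : vocabulary)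
    (e : equation alpha) :
  true_in (Fm_plus L alpha) e <-> logical_consequence (@P_axiom alpha) e.
Proof.
split=> [true_e A AP v | csq]; last exact: csq _ Fm_plus_P.
have alpha_gt0: 0 < alpha by apply: ltn_trans halpha.
rewrite !(eval_normalize (model_actP AP)).
by rewrite (normalize_eq_of_true (Ordinal alpha_gt0) e true_e).
Qed.
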